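(* Let $A$ be a continuous dcpo and let $\mu$ be a CC-valuation on its Scott open sets, extended to the unique finitely additive measure (also denoted $\mu$) on the ring $\mathcal M$ of subsets of $A$ generated by the Scott open sets. For $x\in A$ put $\mathrm{Info}(x)=C_x=\{y\mid y\sqsubseteq x\}$, $I_x=\{y\mid\{x,y\}\text{ has no upper bound in }A\}$, $J_x=\{y\in A\mid x\in\mathrm{Int}(I_y)\}$, $\mathrm{Neginfo}(x)=J'_x=\mathrm{Int}(J_x)$, and $$u(x,y)=1-\mu(C_x\cap C_y)-\mu(J'_x\cap J'_y),\qquad l(x,y)=\mu(C_x\cap J'_y)+\mu(C_y\cap J'_x).$$ Then $(A,A,\mathcal M,\mu,\mathrm{Info},\mathrm{Neginfo})$ is a (possibly deficient) $\mu$Info-structure on $A$; consequently $u$ is a partial metric, $\rho=[l,u]:A\times A\to R^I$ is a Scott continuous relaxed metric, and the relaxed metric topology coincides with the Scott topology. If moreover $A$ satisfies the Lawson condition, then this $\mu$Info-structure is not deficient (i.e. strong respect for totality holds); consequently $l(x,y)=u(x,y)$ for all $x,y\in\mathrm{Total}(A)$, and $d(x,y)=l(x,y)=u(x,y)$ is a metric on $\mathrm{Total}(A)$ whose topology is the subspace topology induced by the Scott topology on $A$.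
   Context: Directed sets are nonempty. A dcpo is a poset with least element in which every directed subset has a least upper bound. $x\ll y$ means: for every directed $S$ with $y\sqsubseteq\sqcup S$ there is $s\in S$ with $x\sqsubseteq s$. A dcpo $A$ is continuous (with basis $K\subseteq A$) if for every $a\in A$ the set $\{k\in K\mid k\ll a\}$ is directed with supremum $a$. $U\subseteq A$ is Scott open if it is upward closed and meets every directed $S$ with $\sqcup S\in U$. $\mathrm{Int}$ is Scott interior. Scott continuous means monotone and preserving directed suprema; $A\times A$ has the coordinatewise order. $\mathrm{Total}(A)$ is the set of maximal elements. The Lawson topology is generated by the Scott open sets and the sets $A\setminus\{z\mid y\sqsubseteq z\}$, $y\in A$. The Lawson condition: the relative Scott and relative Lawson topologies on $\mathrm{Total}(A)$ are equal. A CC-valuation is a function $\mu$ from Scott open sets to $[0,1]$ with $\mu(\emptyset)=0$, $\mu(A)=1$, $U\subseteq V\Rightarrow\mu(U)\le\mu(V)$, $\mu(U)+\mu(V)=\mu(U\cap V)+\mu(U\cup V)$, which is continuous ($\mu(\bigcup_iU_i)=\sup_i\mu(U_i)$ for directed systems of open sets), strongly non-degenerate ($U\subsetneq V\Rightarrow\mu(U)<\mu(V)$) and co-continuous ($\mu(\mathrm{Int}(\bigcap_iU_i))=\inf_i\mu(U_i)$ for filtered, i.e. nonempty downward directed, systems of open sets). A $\mu$Info-structure on a dcpo $A$ is a tuple $(A,\mathcal I,\mathcal M(\mathcal I),\mu,\mathrm{Info},\mathrm{Neginfo})$ where $\mathcal I$ is a set, $\mathcal M(\mathcal I)\subseteq\mathcal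 P(\mathcal I)$ is closed under $\cap,\cup,\setminus$ and contains $\emptyset,\mathcal I$, $\mu:\mathcal M(\mathcal I)\to[0,1]$, $\mathrm{Info},\mathrm{Neginfo}:A\to\mathcal M(\mathcal I)$, satisfying: 1. $\mu(\mathcal I)=1$, $\mu(\emptyset)=0$; $U\subseteq V\Rightarrow\mu(U)\le\mu(V)$; $\mu(U)+\mu(V)=\mu(U\cap V)+\mu(U\cup V)$. 2. $x\sqsubseteq y\Leftrightarrow\mathrm{Info}(x)\subseteq\mathrm{Info}(y)$; $x\sqsubset y\Rightarrow\mathrm{Info}(x)\subsetneq\mathrm{Info}(y)$. 3. $\mathrm{Info}(x)\cap\mathrm{Neginfo}(x)=\emptyset$; $x\sqsubseteq y\Rightarrow\mathrm{Neginfo}(x)\subseteq\mathrm{Neginfo}(y)$. 4. (Strong respect for totality) $x\in\mathrm{Total}(A)\Rightarrow\mathrm{Info}(x)\cup\mathrm{Neginfo}(x)=\mathcal I$. 5. For every directed $B\subseteq A$, $y\in A$ and $P,Q\in\{\mathrm{Info},\mathrm{Neginfo}\}$: $\mu(P(\sqcup B)\cap Q(y))=\sup_{x\in B}\mu(P(x)\cap Q(y))$. 6. For every Scott open $U$ and $x\in U$ there is $\epsilon>0$ such that for all $y\in A$, $\mu(\mathrm{Info}(x))-\mu(\mathrm{Info}(x)\cap\mathrm{Info}(y))<\epsilon$ implies $y\in U$. It is deficient when axiom 4 is not imposed. $R^I$ is the domain of intervals $[a,b]$, $0\le a\le b\le+\infty$, with $[a,b]\sqsubseteq[c,d]$ iff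 $a\le c$ and $d\le b$. A symmetric $\rho=[l,u]:A\times A\to R^I$ is a relaxed metric if $u(x,z)\le u(x,y)+u(y,z)$. The relaxed metric topology: $U$ is open iff for each $x\in U$ there is a real $\epsilon>u(x,x)$ with $\{y\mid u(x,y)<\epsilon\}\subseteq U$. A partial metric is a function $p\ge0$ with: $x=y$ iff $p(x,x)=p(x,y)=p(y,y)$; $p(x,x)\le p(x,y)$; $p(x,y)=p(y,x)$; $p(x,z)\le p(x,y)+p(y,z)-p(y,y)$; and moreover $p(x,x)=p(x,y)$ if $x\sqsubseteq y$, $p(x,x)<p(x,y)$ if $x\not\sqsubseteq y$. *)

(* Defs.v *)
From HB Require Import structures.
From mathcomp Require Import all_boot all_order all_algebra.
From mathcomp Require Import all_classical all_reals.
From mathcomp Require Import ereal measurable_structure.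

Set Implicit Arguments.
Unset Strict Implicit.
Unset Printing Implicit Defensive.

Import Order.TTheory GRing.Theory Num.Theory.
Local Open Scope classical_set_scope.
Local Open Scope ring_scope.

(* [directed_by r S] is used with the order of a poset, with inclusion of sets
   (directed systems) and with reverse inclusion (filtered systems). *)
Definition directed_by (T : Type) (r : T -> T -> Prop) (S : set T) : Prop :=
  S !=set0 /\
  forall x y, S x -> S y -> exists z, [/\ S z, r x z & r y z].

Section Domains.
Context {d : Order.disp_t}.
Implicit Type A : porderType d.

Definition directed A (S : set A) : Prop :=
  directed_by (fun x y => (x <= y)%O) S.

Definition is_dcpo A : Prop :=
  (exists bot : A, forall x : A, (bot <= x)%O) /\
  forall S : set A, directed S -> exists s, isLub S s.

Definition way_below A (x y : A) : Prop :=
  forall (S : set A) (s : A), directed S -> isLub S s -> (y <= s)%O ->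
  exists2 z, S z & (x <= z)%O.

Definition is_basis A (K : set A) : Prop :=
  forall a : A, directed [set k | K k /\ way_below k a] /\
                isLub [set k | K k /\ way_below k a] a.

Definition continuous_dcpo A : Prop :=
  is_dcpo A /\ exists K : set A, is_basis K.

Definition scott_open A (U : set A) : Prop :=
  (forall x y, U x -> (x <= y)%O -> U y) /\
  (forall (S : set A) (s : A), directed S -> isLub S s -> U s -> S `&` U !=set0).

Definition scott_interior A (S : set A) : set A :=
  \bigcup_(U in [set U : set A | scott_open U /\ U `<=` S]) U.

Definition total_set A : set A := [set x | forall y, (x <= y)%O -> y = x].

Definition is_topology (T : Type) (O : set (set T)) : Prop :=
  [/\ O setT, setI_closed O &
      forall F : set (set T), F `<=` O -> O (\bigcup_(U in F) U)].

Definition lawson_open A : set (set A) :=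
  smallest (@is_topology A)
    (@scott_open A `|` [set ~` [set z | (y <= z)%O] | y in [set: A]]).

Definition relative_opens (T : Type) (O : set (set T)) (D : set T) :
  set (set T) := [set U `&` D | U in O].

Definition lawson_condition A : Prop :=
  relative_opens (@scott_open A) (@total_set A) =
  relative_opens (@lawson_open A) (@total_set A).

End Domains.

Arguments total_set {d} A.
Arguments is_dcpo {d} A.
Arguments continuous_dcpo {d} A.
Arguments lawson_condition {d} A.

Definition scott_continuous (d d' : Order.disp_t) (A : porderType d)
    (B : porderType d') (f : A -> B) : Prop :=
  {homo f : x y / (x <= y)%O} /\
  forall (S : set A) (s : A), directed S -> isLub S s -> isLub (f @` S) (f s).

(* A function on Scott open sets is represented by a function on all subsets,
   whose values elsewhere are irrelevant. *)
Record cc_valuation (R : realType) (d : Order.disp_t) (A : porderType d)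
    (mu : set A -> R) : Prop := {
  cc_range : forall U, scott_open U -> 0 <= mu U <= 1;
  cc_set0 : mu set0 = 0;
  cc_setT : mu setT = 1;
  cc_mono : forall U V, scott_open U -> scott_open V ->
    U `<=` V -> mu U <= mu V;
  cc_modular : forall U V, scott_open U -> scott_open V ->
    mu U + mu V = mu (U `&` V) + mu (U `|` V);
  cc_continuous : forall F : set (set A), F `<=` @scott_open d A ->
    directed_by (fun U V => U `<=` V) F ->
    mu (\bigcup_(U in F) U) = sup (mu @` F);
  cc_nondegenerate : forall U V, scott_open U -> scott_open V ->
    U `<` V -> mu U < mu V;
  cc_cocontinuous : forall F : set (set A), F `<=` @scott_open d A ->
    directed_by (fun U V => V `<=` U) F ->
    mu (scott_interior (\bigcap_(U in F) U)) = inf (mu @` F) }.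

Definition finitely_additive_measure (R : realType) (T : Type)
    (M : set (set T)) (nu : set T -> R) : Prop :=
  [/\ nu set0 = 0,
      forall U, M U -> 0 <= nu U &
      forall U V, M U -> M V -> U `&` V = set0 -> nu (U `|` V) = nu U + nu V].

Definition scott_ring (d : Order.disp_t) (A : porderType d) : set (set A) :=
  <<r @scott_open d A >>.
Arguments scott_ring {d} A.

Definition ring_extension (R : realType) (d : Order.disp_t) (A : porderType d)
    (mu nu : set A -> R) : Prop :=
  finitely_additive_measure (scott_ring A) nu /\
  forall U, scott_open U -> nu U = mu U.

(* All axioms of a muInfo-structure except strong respect for totality. *)
Record deficient_muInfo (R : realType) (d : Order.disp_t) (A : porderType d)
    (I : Type) (M : set (set I)) (mu : set I -> R) (Info Neginfo : A -> set I) :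
    Prop := {
  mi_set0 : M set0;
  mi_setT : M setT;
  mi_setI : setI_closed M;
  mi_setU : setU_closed M;
  mi_setD : setD_closed M;
  mi_range : forall U, M U -> 0 <= mu U <= 1;
  mi_info : forall x, M (Info x);
  mi_neginfo : forall x, M (Neginfo x);
  mi_muT : mu setT = 1;
  mi_mu0 : mu set0 = 0;
  mi_mono : forall U V, M U -> M V -> U `<=` V -> mu U <= mu V;
  mi_modular : forall U V, M U -> M V ->
    mu U + mu V = mu (U `&` V) + mu (U `|` V);
  mi_info_le : forall x y, (x <= y)%O <-> Info x `<=` Info y;
  mi_info_lt : forall x y, (x < y)%O -> Info x `<` Info y;
  mi_disjoint : forall x, Info x `&` Neginfo x = set0;
  mi_neginfo_le : forall x y, (x <= y)%O -> Neginfo x `<=` Neginfo y;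
  mi_sup : forall (B : set A) (b y : A) (P Q : A -> set I),
    directed B -> isLub B b ->
    P = Info \/ P = Neginfo -> Q = Info \/ Q = Neginfo ->
    mu (P b `&` Q y) = sup [set mu (P x `&` Q y) | x in B];
  mi_scott : forall (U : set A) (x : A), scott_open U -> U x ->
    exists2 e : R, 0 < e &
      forall y, mu (Info x) - mu (Info x `&` Info y) < e -> U y }.

Definition strong_respect_for_totality (d : Order.disp_t) (A : porderType d)
    (I : Type) (Info Neginfo : A -> set I) : Prop :=
  forall x, total_set A x -> Info x `|` Neginfo x = setT.

Definition muInfo_structure (R : realType) (d : Order.disp_t)
    (A : porderType d) (I : Type) (M : set (set I)) (mu : set I -> R)
    (Info Neginfo : A -> set I) : Prop :=
  deficient_muInfo M mu Info Neginfo /\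
  strong_respect_for_totality Info Neginfo.

(* The domain R^I of intervals [a, b] with 0 <= a <= b <= +oo. *)
Definition interval_dom (R : realType) : Type :=
  {ab : \bar R * \bar R | (0 <= ab.1)%E && (ab.1 <= ab.2)%E}.

HB.instance Definition _ (R : realType) := Choice.on (interval_dom R).

Definition lower (R : realType) (i : interval_dom R) : \bar R := (val i).1.
Definition upper (R : realType) (i : interval_dom R) : \bar R := (val i).2.

Section IntervalOrder.
Context {R : realType}.
Implicit Types i j k : interval_dom R.

Definition interval_le i j : bool :=
  (lower i <= lower j)%E && (upper j <= upper i)%E.

Lemma interval_le_refl : reflexive interval_le.
Proof. by move=> i; rewrite /interval_le !lexx. Qed.

Lemma interval_le_anti : antisymmetric interval_le.
Proof.
move=> i j /andP[/andP[l1 u1] /andP[l2 u2]]; apply: val_inj.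
rewrite [LHS]surjective_pairing [RHS]surjective_pairing.
by congr (_, _); apply: le_anti; apply/andP; split.
Qed.

Lemma interval_le_trans : transitive interval_le.
Proof.
move=> j i k /andP[l1 u1] /andP[l2 u2].
by apply/andP; split; [exact: le_trans l1 l2|exact: le_trans u2 u1].
Qed.

End IntervalOrder.

Fact interval_dom_display : Order.disp_t. Proof. by []. Qed.

HB.instance Definition _ (R : realType) :=
  Order.Le_isPOrder.Build interval_dom_display (interval_dom R)
    (@interval_le_refl R) (@interval_le_anti R) (@interval_le_trans R).

Definition relaxed_metric (R : realType) (T : Type)
    (rho : T * T -> interval_dom R) : Prop :=
  (forall x y, rho (x, y) = rho (y, x)) /\
  (forall x y z,
     (upper (rho (x, z)) <= upper (rho (x, y)) + upper (rho (y, z)))%E).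

Definition relaxed_metric_open (R : realType) (T : Type)
    (rho : T * T -> interval_dom R) : set (set T) :=
  [set U | forall x, U x ->
     exists2 e : R, (upper (rho (x, x)) < e%:E)%E &
       [set y | (upper (rho (x, y)) < e%:E)%E] `<=` U].

Record partial_metric (R : realType) (d : Order.disp_t) (A : porderType d)
    (p : A -> A -> R) : Prop := {
  pm_ge0 : forall x y, 0 <= p x y;
  pm_eq : forall x y, x = y <-> p x x = p x y /\ p x y = p y y;
  pm_small : forall x y, p x x <= p x y;
  pm_sym : forall x y, p x y = p y x;
  pm_triangle : forall x y z, p x z <= p x y + p y z - p y y;
  pm_le : forall x y, (x <= y)%O -> p x x = p x y;
  pm_nle : forall x y, ~ (x <= y)%O -> p x x < p x y }.

Record metric_on (R : realType) (T : Type) (D : set T) (dist : T -> T -> R) :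
    Prop := {
  mo_ge0 : forall x y, D x -> D y -> 0 <= dist x y;
  mo_eq0 : forall x y, D x -> D y -> dist x y = 0 <-> x = y;
  mo_sym : forall x y, D x -> D y -> dist x y = dist y x;
  mo_triangle : forall x y z, D x -> D y -> D z ->
    dist x z <= dist x y + dist y z }.

Definition metric_opens_on (R : realType) (T : Type) (D : set T)
    (dist : T -> T -> R) : set (set T) :=
  [set V | V `<=` D /\ forall x, V x ->
     exists2 e : R, 0 < e & [set y | D y /\ dist x y < e] `<=` V].

Section InfoMaps.
Context {d : Order.disp_t} {A : porderType d}.
Implicit Types x y : A.

Definition Cset x : set A := [set y | (y <= x)%O].

(* [Iset x] is the set of the elements inconsistent with x. *)
Definition Iset x : set A :=
  [set y | ~ exists z : A, (x <= z)%O /\ (y <= z)%O].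

Definition Jset x : set A := [set y | scott_interior (Iset y) x].

Definition Jset' x : set A := scott_interior (Jset x).

Context {R : realType}.
Variable nu : set A -> R.

Definition u_dist x y : R :=
  1 - nu (Cset x `&` Cset y) - nu (Jset' x `&` Jset' y).

Definition l_dist x y : R :=
  nu (Cset x `&` Jset' y) + nu (Cset y `&` Jset' x).

End InfoMaps.

(* Main.v *)
Require Import Defs.
From HB Require Import structures.
From mathcomp Require Import all_boot all_order all_algebra.
From mathcomp Require Import all_classical all_reals.
From mathcomp Require Import ereal measurable_structure.
From mathcomp Require Import ring lra.

Set Implicit Arguments.
Unset Strict Implicit.
Unset Printing Implicit Defensive.

Import Order.TTheory GRing.Theory Num.Theory.
Local Open Scope classical_set_scope.
Local Open Scope ring_scope.

(* A modular function on a lattice of sets extends to the generated ring because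
   a nonnegative combination of indicator functions of lattice sets has a
   nonnegative weighted sum: cut the space along one set after the other.
   Co-continuity applies to Info because the complement of [Cset b] is the
   interior of the intersection of the complements of the [Cset x], [x] in [B],
   and continuity applies to Neginfo because [Jset' b] is the union of the
   [Jset' x]; the latter is where interpolation for way-below is needed. *)

(** * Extension of a modular set function from a lattice of sets to the generated ring *)

Section LatticeExtension.
Variables (R : realType) (T : Type).
Implicit Types (L M : set (set T)) (m nu : set T -> R) (s t : seq (R * set T)).

(** A list of weighted sets encodes a formal combination of indicator functions; [weighted_sum] is
    its integral against [m]. *)
Definition simple_fun s (x : T) : R := \sum_(p <- s) p.1 * (x \in p.2)%:R.

Definition weighted_sum m s : R := \sum_(p <- s) p.1 * m p.2.

Definition sets_in L s := all (fun p => p.2 \in L) s.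

Definition represents L s (S : set T) :=
  sets_in L s /\ forall x, (x \in S)%:R = simple_fun s x.

Definition modular_on L m := forall U V, L U -> L V ->
  m U + m V = m (U `&` V) + m (U `|` V).

Definition monotone_on L m := forall U V, L U -> L V -> U `<=` V -> m U <= m V.

Section Positivity.
Variables (L : set (set T)) (m : set T -> R).
Hypotheses (LI : setI_closed L) (LU : setU_closed L).
Hypotheses (mono : monotone_on L m) (modular : modular_on L m).

(** For a measure this is the measure of the difference of [X] and [Y], written with lattice sets
    only because a lattice need not contain differences. *)
Definition gap (X Y : set T) := m X - m (X `&` Y).

(** Modularity is applied to the intersections of [X] with [Y] and with [U]. *)
Lemma gap_split X Y U : L X -> L Y -> L U ->
  gap X Y = gap (X `&` U) Y + gap X (Y `|` U).
Proof.
move=> LX LY LU'; have := modular (LI LX LY) (LI LX LU').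
rewrite /gap -setIUr; have -> : X `&` Y `&` (X `&` U) = X `&` U `&` Y.
  by apply/seteqP; split=> z /=; tauto.
by move=> ?; lra.
Qed.

Lemma simple_fun_cons a U s x :
  simple_fun ((a, U) :: s) x = a * (x \in U)%:R + simple_fun s x.
Proof. by rewrite /simple_fun big_cons. Qed.

(* The induction splits the region [X `\` Y] along the first set of the list;
   [c] collects the coefficients of the sets already known to contain it. *)
Lemma gap_sum_ge0 s c X Y : L X -> L Y -> sets_in L s ->
  (forall x, X x -> ~ Y x -> 0 <= c + simple_fun s x) ->
  0 <= c * gap X Y + \sum_(p <- s) p.1 * gap (X `&` p.2) Y.
Proof.
elim: s c X Y => [|[a U] s IHs] c X Y LX LY /= Ls pos.
  rewrite big_nil addr0.
  (* With no set left, either the gap vanishes or a point of [X] outside [Y] shows that [c] is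
     nonnegative. *)
  have [XY|] := pselect (X `<=` Y).
    by rewrite /gap (setIidl XY) subrr mulr0.
  move=> /existsNP[x /not_implyP[Xx nYx]]; apply: mulr_ge0.
    by move: (pos x Xx nYx); rewrite /simple_fun big_nil addr0.
  by rewrite subr_ge0; apply: mono => //; exact: LI.
have /andP[/set_mem /= LU' Ls'] := Ls.
have in_U : 0 <= (c + a) * gap (X `&` U) Y +
    \sum_(p <- s) p.1 * gap (X `&` U `&` p.2) Y.
  apply: IHs => //; first exact: LI.
  move=> x [Xx Ux] nYx; move: (pos x Xx nYx).
  by rewrite simple_fun_cons mem_set// mulr1 addrA.
have off_U : 0 <= c * gap X (Y `|` U) +
    \sum_(p <- s) p.1 * gap (X `&` p.2) (Y `|` U).
  apply: IHs => //; first exact: LU.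
  move=> x Xx /not_orP[nYx nUx]; move: (pos x Xx nYx).
  by rewrite simple_fun_cons memNset// mulr0 add0r.
rewrite big_cons /= (gap_split LX LY LU').
suff -> : \sum_(p <- s) p.1 * gap (X `&` p.2) Y =
    \sum_(p <- s) p.1 * gap (X `&` U `&` p.2) Y +
    \sum_(p <- s) p.1 * gap (X `&` p.2) (Y `|` U) by lra.
elim: s Ls' {IHs Ls pos in_U off_U} => [|p s IHs] /=.
  by rewrite !big_nil addr0.
move=> /andP[/set_mem Lp Ls]; rewrite !big_cons IHs//.
by rewrite (gap_split (LI LX Lp) LY LU') setIAC; ring.
Qed.

End Positivity.

Lemma simple_fun_cat s t x :
  simple_fun (s ++ t) x = simple_fun s x + simple_fun t x.
Proof. by rewrite /simple_fun big_cat. Qed.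

Lemma weighted_sum_cat m s t :
  weighted_sum m (s ++ t) = weighted_sum m s + weighted_sum m t.
Proof. by rewrite /weighted_sum big_cat. Qed.

Definition neg_weights s := [seq (- p.1, p.2) | p <- s].

Lemma simple_fun_neg s x : simple_fun (neg_weights s) x = - simple_fun s x.
Proof.
rewrite /simple_fun big_map -sumrN.
by apply: eq_bigr => p _; rewrite mulNr.
Qed.

Lemma weighted_sum_neg m s : weighted_sum m (neg_weights s) = - weighted_sum m s.
Proof.
rewrite /weighted_sum big_map -sumrN.
by apply: eq_bigr => p _; rewrite mulNr.
Qed.

Lemma sets_in_cat L s t : sets_in L (s ++ t) = sets_in L s && sets_in L t.
Proof. exact: all_cat. Qed.

Lemma sets_in_neg L s : sets_in L (neg_weights s) = sets_in L s.
Proof. by rewrite /sets_in all_map. Qed.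

Definition mul_weights s t :=
  [seq (p.1 * q.1, p.2 `&` q.2) | p <- s, q <- t].

Lemma simple_fun_mul s t x :
  simple_fun (mul_weights s t) x = simple_fun s x * simple_fun t x.
Proof.
rewrite /simple_fun big_allpairs_dep mulr_suml; apply: eq_bigr => p _.
rewrite mulr_sumr; apply: eq_bigr => q _ /=.
by rewrite in_setI -mulnb natrM; ring.
Qed.

Lemma sets_in_mul L s t : setI_closed L ->
  sets_in L s -> sets_in L t -> sets_in L (mul_weights s t).
Proof.
move=> LI /allP Ls /allP Lt; apply/allP => r.
move=> /allpairsP[[p q] [ps qt ->]]; apply/mem_set/LI; apply/set_mem.
  exact: Ls.
exact: Lt.
Qed.

Section Representation.
Variables (L : set (set T)).
Hypotheses (L0 : L set0) (LT : L setT) (LI : setI_closed L) (LU : setU_closed L).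

(** This is [gap_sum_ge0] with [X] the whole space, [Y] empty and [c] zero, where the gap of a set
    is its value under [m]. *)
Lemma weighted_sum_ge0 m s : m set0 = 0 -> monotone_on L m -> modular_on L m ->
  sets_in L s -> (forall x, 0 <= simple_fun s x) -> 0 <= weighted_sum m s.
Proof.
move=> m0 mono modular Ls pos.
have := gap_sum_ge0 LI LU mono modular (c := 0) LT L0 Ls.
rewrite mul0r add0r /gap.
under eq_bigr do rewrite setI0 m0 subr0 setTI.
by apply=> x _ _; rewrite add0r.
Qed.

(** The integral depends only on the function: both differences of the two combinations vanish
    pointwise, hence have nonnegative sums. *)
Lemma weighted_sum_eq m s t : m set0 = 0 -> monotone_on L m -> modular_on L m ->
  sets_in L s -> sets_in L t -> simple_fun s =1 simple_fun t ->
  weighted_sum m s = weighted_sum m t.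
Proof.
move=> m0 mono modular Ls Lt st; apply: le_anti; apply/andP; split.
- rewrite -subr_ge0 -weighted_sum_neg -weighted_sum_cat.
  apply: weighted_sum_ge0; rewrite ?sets_in_cat ?sets_in_neg ?Ls ?Lt//.
  by move=> x; rewrite simple_fun_cat simple_fun_neg st subrr.
- rewrite -subr_ge0 -weighted_sum_neg -weighted_sum_cat.
  apply: weighted_sum_ge0; rewrite ?sets_in_cat ?sets_in_neg ?Ls ?Lt//.
  by move=> x; rewrite simple_fun_cat simple_fun_neg st subrr.
Qed.

Lemma represents_gen U : L U -> represents L [:: (1, U)] U.
Proof.
move=> LU'; split=> [|x]; first by rewrite /sets_in /= mem_set.
by rewrite /simple_fun big_seq1 mul1r.
Qed.

(** The indicator of a difference is [1_S - 1_S * 1_V]; that of a union, treated next, is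
    [1_S + 1_V - 1_S * 1_V]. *)
Lemma represents_setD s t S V : represents L s S -> represents L t V ->
  represents L (s ++ neg_weights (mul_weights s t)) (S `\` V).
Proof.
move=> [Ls sS] [Lt tV]; split.
  by rewrite sets_in_cat sets_in_neg Ls sets_in_mul.
move=> x; rewrite simple_fun_cat simple_fun_neg simple_fun_mul -sS -tV in_setD.
by case: (x \in S); case: (x \in V) => /=; ring.
Qed.

Lemma represents_setU s t S V : represents L s S -> represents L t V ->
  represents L (s ++ t ++ neg_weights (mul_weights s t)) (S `|` V).
Proof.
move=> [Ls sS] [Lt tV]; split.
  by rewrite !sets_in_cat sets_in_neg Ls Lt sets_in_mul.
move=> x.
rewrite !simple_fun_cat simple_fun_neg simple_fun_mul -sS -tV in_setU.
by case: (x \in S); case: (x \in V) => /=; ring.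
Qed.

Lemma setring_represented S : <<r L >> S -> exists s, represents L s S.
Proof.
(* Membership in the generated ring is applied to one particular ring containing [L], that of all
   represented sets. *)
move=> /(_ [set S | exists s, represents L s S]); apply; split; last first.
  by move=> U LU' /=; exists [:: (1, U)]; exact: represents_gen.
split=> [|U V [s ?] [t ?]|U V [s ?] [t ?]].
- by exists [:: (1, set0)]; exact: represents_gen.
- by exists (s ++ t ++ neg_weights (mul_weights s t)); exact: represents_setU.
- by exists (s ++ neg_weights (mul_weights s t)); exact: represents_setD.
Qed.

End Representation.

Lemma setring_setI M : setring M -> setI_closed M.
Proof. by move=> [_ _ MD] U V MU MV; rewrite -setDD; apply/MD => //; apply: MD. Qed.

Section FinitelyAdditive.
Variables (M : set (set T)) (nu : set T -> R).
Hypotheses (ringM : setring M) (fam : finitely_additive_measure M nu).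

Let MI : setI_closed M := setring_setI ringM.
Let MD : setD_closed M. Proof. by case: ringM. Qed.

Lemma measure_split U V : M U -> M V -> nu U = nu (U `&` V) + nu (U `\` V).
Proof.
case: fam => _ _ add MU MV; rewrite -add ?setIUDK//.
- by rewrite setUIDK.
- exact: MI.
- exact: MD.
by apply/seteqP; split=> z //= [[_ ?] []].
Qed.

Lemma measure_mono : monotone_on M nu.
Proof.
case: fam => _ ge0 _ U V MU MV UV.
by rewrite (measure_split MV MU) (setIidr UV) lerDl ge0//; exact: MD.
Qed.

Lemma measure_modular : modular_on M nu.
Proof.
case: fam ringM => _ _ add [_ MU' _] U V MU MV.
rewrite (measure_split MU MV) (measure_split (MU' _ _ MU MV) MV).
have -> : (U `|` V) `&` V = V by apply/seteqP; split=> z /=; tauto.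
have -> : (U `|` V) `\` V = U `\` V by apply/seteqP; split=> z /=; tauto.
by ring.
Qed.

End FinitelyAdditive.

Section Extension.
Variable L : set (set T).
Hypotheses (L0 : L set0) (LT : L setT) (LI : setI_closed L) (LU : setU_closed L).

(** [nu] is monotone and modular on the whole ring, so [weighted_sum_eq] applies with the ring in
    place of [L], to [s] and the one-term list of [S]. *)
Lemma measure_represented nu s S : finitely_additive_measure <<r L >> nu ->
  represents L s S -> <<r L >> S -> nu S = weighted_sum nu s.
Proof.
move=> fam [Ls sS] rS; have [nu0 _ _] := fam.
have ringL := smallest_setring L.
have LrL U : L U -> <<r L >> U by exact: sub_setring.
have -> : nu S = weighted_sum nu [:: (1, S)].
  by rewrite /weighted_sum big_seq1 mul1r.
apply: (@weighted_sum_eq <<r L >>) => //.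
- exact: LrL.
- exact: setring_setI.
- exact: setringU.
- exact: measure_mono.
- exact: measure_modular.
- by rewrite /sets_in /= mem_set.
- by apply/allP => p /(allP Ls) /set_mem /LrL /mem_set.
- by move=> x; rewrite -sS /simple_fun big_seq1 mul1r.
Qed.

Lemma extension_unique m nu nu' :
  finitely_additive_measure <<r L >> nu -> (forall U, L U -> nu U = m U) ->
  finitely_additive_measure <<r L >> nu' -> (forall U, L U -> nu' U = m U) ->
  forall S, <<r L >> S -> nu S = nu' S.
Proof.
move=> fam num fam' nu'm S rS; have [s sS] := setring_represented L0 LI rS.
rewrite (measure_represented fam sS rS) (measure_represented fam' sS rS).
apply: eq_big_seq => p /(allP sS.1) /set_mem Lp.
by rewrite num// nu'm.
Qed.

(** A set is measured by the integral of any representation of its indicator; concatenated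
    representations of disjoint sets represent the union, whence additivity. *)
Lemma extension_exists m : m set0 = 0 -> monotone_on L m -> modular_on L m ->
  exists2 nu, finitely_additive_measure <<r L >> nu &
    forall U, L U -> nu U = m U.
Proof.
move=> m0 mono modular.
(* [xget] picks some representation; the empty list is the default for sets that have none. *)
pose nu S := weighted_sum m (xget [::] [set s | represents L s S]).
have nuE s S : represents L s S -> nu S = weighted_sum m s.
  move=> sS; rewrite /nu; case: xgetP => [t _ [Lt tS]|/(_ s)//].
  have [Ls sS'] := sS.
  by apply: (@weighted_sum_eq L) => // x; rewrite -tS -sS'.
have nuL U : L U -> nu U = m U.
  move=> LU'; rewrite (nuE _ _ (represents_gen LU')).
  by rewrite /weighted_sum big_seq1 mul1r.
exists nu => //; split=> [|S rS|S V rS rV SV0].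
- by rewrite nuL.
- have [s sS] := setring_represented L0 LI rS; rewrite (nuE _ _ sS).
  by apply: (@weighted_sum_ge0 L) => // [|x]; [case: sS | rewrite -sS.2].
- have [s sS] := setring_represented L0 LI rS; have [t tV] := setring_represented L0 LI rV.
  rewrite (nuE _ _ sS) (nuE _ _ tV) -weighted_sum_cat; apply: nuE; split.
    by rewrite sets_in_cat sS.1 tV.1.
  move=> x; rewrite simple_fun_cat -sS.2 -tV.2 in_setU.
  have : x \notin S `&` V by rewrite SV0 in_set0.
  rewrite in_setI; case: (x \in S); case: (x \in V) => //= _;
    by rewrite ?addr0 ?add0r.
Qed.

End Extension.

End LatticeExtension.

(** * Scott topology, the way-below relation and the sets [Cset], [Iset], [Jset'] *)

Section ScottTopology.
Context {d : Order.disp_t} {A : porderType d}.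
Implicit Types (x y z : A) (U V S B K : set A).

Lemma scott_open0 : scott_open (@set0 A).
Proof. by split. Qed.

Lemma scott_openT : scott_open [set: A].
Proof. by split=> // S s [[x Sx] _] _ _; exists x. Qed.

Lemma scott_openI U V : scott_open U -> scott_open V -> scott_open (U `&` V).
Proof.
move=> [upU supU] [upV supV]; split=> [x y [Ux Vx] xy|S s dirS lubS [Us Vs]].
  by split; [exact: upU xy | exact: upV xy].
have [x [Sx Ux]] := supU S s dirS lubS Us.
have [y [Sy Vy]] := supV S s dirS lubS Vs.
have [z [Sz xz yz]] := dirS.2 x y Sx Sy.
by exists z; split => //; split; [exact: upU xz | exact: upV yz].
Qed.

Lemma scott_open_bigcup (F : set (set A)) :
  F `<=` @scott_open d A -> scott_open (\bigcup_(U in F) U).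
Proof.
move=> openF; split=> [x y [U FU Ux] xy|S s dirS lubS [U FU Us]].
  by exists U => //; exact: (openF U FU).1 xy.
have [x [Sx Ux]] := (openF U FU).2 S s dirS lubS Us.
by exists x; split=> //; exists U.
Qed.

Lemma scott_openU U V : scott_open U -> scott_open V -> scott_open (U `|` V).
Proof.
move=> [upU supU] [upV supV]; split=> [x y [Ux|Vx] xy|S s dirS lubS [Us|Vs]].
- by left; exact: upU xy.
- by right; exact: upV xy.
- by have [x [Sx Ux]] := supU S s dirS lubS Us; exists x; split=> //; left.
- by have [x [Sx Vx]] := supV S s dirS lubS Vs; exists x; split=> //; right.
Qed.

Lemma scott_interior_open S : scott_open (scott_interior S).
Proof. by apply: scott_open_bigcup => U []. Qed.

Lemma scott_interior_sub S : scott_interior S `<=` S.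
Proof. by move=> x [U [_ US] /US]. Qed.

Lemma scott_interior_max U S : scott_open U -> U `<=` S -> U `<=` scott_interior S.
Proof. by move=> oU US x Ux; exists U. Qed.

Lemma scott_interiorS S S' : S `<=` S' -> scott_interior S `<=` scott_interior S'.
Proof. by move=> SS' x [U [oU US] Ux]; exists U => //; split=> // z /US /SS'. Qed.

(** A directed set inside [Cset x] has [x] as an upper bound, so its supremum stays in [Cset x]. *)
Lemma scott_open_Cset_compl x : scott_open (~` Cset x).
Proof.
split=> [y z nyx yz zx|S s _ [_ least] nsx]; first by apply: nyx; exact: le_trans zx.
apply: contrapT => S0; apply: nsx; apply: least => y Sy.
by apply: contrapT => nyx; apply: S0; exists y.
Qed.

Lemma CsetS x y : (x <= y)%O -> Cset x `<=` Cset y.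
Proof. by move=> xy z zx; exact: le_trans xy. Qed.

Lemma IsetS x y : (x <= y)%O -> Iset x `<=` Iset y.
Proof.
by move=> xy z nxz [w [yw zw]]; apply: nxz; exists w; split=> //; exact: le_trans yw.
Qed.

Lemma Jset_up x y z : Jset x y -> (y <= z)%O -> Jset x z.
Proof. by move=> xy /IsetS /scott_interiorS; apply. Qed.

Lemma JsetS x y : (x <= y)%O -> Jset x `<=` Jset y.
Proof. by move=> xy z zx; exact: (scott_interior_open (Iset z)).1 xy. Qed.

Lemma Jset'S x y : (x <= y)%O -> Jset' x `<=` Jset' y.
Proof. by move=> xy; exact/scott_interiorS/JsetS. Qed.

Lemma Cset_Jset'_disj x : Cset x `&` Jset' x = set0.
Proof.
apply/seteqP; split=> // y [/= yx /scott_interior_sub /scott_interior_sub].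
by apply; exists x.
Qed.

(** If an open set disjoint from every [Cset x] held some [z] below [b], it would hold [b], hence
    some [x] in [B], which lies in its own [Cset x]. *)
Lemma Cset_compl_sup B (b : A) : directed B -> isLub B b ->
  ~` Cset b = scott_interior (\bigcap_(U in [set ~` Cset x | x in B]) U).
Proof.
move=> dirB lubB; apply/seteqP; split.
  apply: scott_interior_max; first exact: scott_open_Cset_compl.
  move=> z nzb _ [x Bx <-] zx; apply: nzb.
  by apply: le_trans zx _; exact: lubB.1.
move=> z [U [oU UB] Uz] zb.
have [x [Bx Ux]] := oU.2 B b dirB lubB (oU.1 z b Uz zb).
by apply: (UB x Ux (~` Cset x)); [exists x | exact: lexx].
Qed.

Lemma way_below_le x y : way_below x y -> (x <= y)%O.
Proof.
move=> /(_ [set y] y)[|||z -> //].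
- by split; [exists y | move=> _ _ -> ->; exists y].
- by split=> [_ ->//|b]; exact.
- exact: lexx.
Qed.

Lemma way_below_trans x y x' y' :
  (x' <= x)%O -> way_below x y -> (y <= y')%O -> way_below x' y'.
Proof.
move=> xx xy yy S s dirS lubS /(le_trans yy) ys.
by have [z Sz xz] := xy S s dirS lubS ys; exists z => //; exact: le_trans xz.
Qed.

Section Basis.
Variable K : set A.
Hypothesis basisK : is_basis K.

(** The basis elements way below some basis element way below [y] form a directed set with supremum
    [y], to which [way_below x y] is applied. *)
Lemma way_below_interpolation x y : way_below x y ->
  exists2 k, way_below x k & way_below k y.
Proof.
move=> xy; pose S := [set j | exists k, [/\ K k, way_below k y, K j & way_below j k]].
have [|||z [k [Kk ky Kz zk]] xz] := xy S y; last 2 first.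
- exact: lexx.
- by exists k => //; exact: way_below_trans zk (lexx k).
- have [[[k [Kk ky]] dir] _] := basisK y; split.
    by have [[[j [Kj jk]] _] _] := basisK k; exists j, k.
  move=> j1 j2 [k1 [Kk1 k1y Kj1 jk1]] [k2 [Kk2 k2y Kj2 jk2]].
  have [//|//|k3 [[Kk3 k3y] k13 k23]] := dir k1 k2.
  have [[_ dir3] _] := basisK k3.
  have [||j [[Kj jk] j1j j2j]] := dir3 j1 j2.
  + by split=> //; exact: way_below_trans (lexx _) jk1 k13.
  + by split=> //; exact: way_below_trans (lexx _) jk2 k23.
  by exists j; split=> //; exists k3.
- split=> [j [k [_ ky _ jk]]|b ubb].
    by apply: le_trans (way_below_le ky); exact: way_below_le.
  have [_ [_ least]] := basisK y; apply: least => k [Kk ky].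
  have [_ [_ leastk]] := basisK k; apply: leastk => j [Kj jk].
  by apply: ubb; exists k.
Qed.

(** Once [k] is interpolated between [x] and the supremum, some member of [S] is above [k], hence
    way above [x]. *)
Lemma way_above_open x : scott_open [set y | way_below x y].
Proof.
split=> [y z xy yz|S s dirS lubS xs]; first exact: way_below_trans xy yz.
have [k xk ks] := way_below_interpolation xs.
have [z Sz kz] := ks S s dirS lubS (lexx s).
by exists z; split=> //; exact: way_below_trans xk kz.
Qed.

Lemma scott_open_way_below U x : scott_open U -> U x ->
  exists2 k, U k & way_below k x.
Proof.
move=> oU Ux; have [dir lub] := basisK x.
by have [k [[_ kx] Uk]] := oU.2 _ _ dir lub Ux; exists k.
Qed.

(** [Jset x] is upward closed, so the open set of points way above [y] is contained in it, and thus
    in its interior. *)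
Lemma way_above_Jset' x y z : Jset x y -> way_below y z -> Jset' x z.
Proof.
move=> xy yz; apply: (scott_interior_max (way_above_open y)) yz => w yw.
exact: Jset_up xy (way_below_le yw).
Qed.

(** A point [z] of the left side has some [k] way below it with [b] in the interior of [Iset k];
    Scott openness replaces [b] by some [x] in [B], and [way_above_Jset'] leads back to [z]. *)
Lemma Jset'_sup B (b : A) : directed B -> isLub B b ->
  Jset' b = \bigcup_(U in [set Jset' x | x in B]) U.
Proof.
move=> dirB lubB; apply/seteqP; split=> [z|z [_ [x Bx <-]]]; last first.
  exact/Jset'S/lubB.1.
move=> /(scott_open_way_below (scott_interior_open _))[k].
move=> /scott_interior_sub bk kz.
have [x [Bx xk]] := (scott_interior_open (Iset k)).2 B b dirB lubB bk.
by exists (Jset' x); [exists x | exact: way_above_Jset' xk kz].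
Qed.

End Basis.

(** Zorn's lemma for the elements above [x]: a nonempty chain is directed and has a supremum, and
    the empty chain is bounded by [x]. *)
Lemma maximal_above x : is_dcpo A -> exists2 y, (x <= y)%O & total_set A y.
Proof.
move=> [_ dcpoA]; pose T := {y : A | (x <= y)%O}.
have [|||C chain|[t xt] maxt] := @Zorn T (fun s t => val s <= val t)%O.
- by move=> t; exact: lexx.
- by move=> r s t; exact: le_trans.
- by move=> s t st ts; apply/val_inj/le_anti; rewrite st ts.
- have [[c Cc]|C0] := pselect (C !=set0); last first.
    by exists (exist _ x (lexx x)) => s Cs; case: C0; exists s.
  have [|m [ubm _]] := dcpoA [set val s | s in C].
    split=> [|_ _ [s Cs <-] [t Ct <-]]; first by exists (val c), c.
    have [st|ts] := chain s t Cs Ct.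
      by exists (val t); split=> //; exists t.
    by exists (val s); split=> //; exists s.
  have xm : (x <= m)%O by apply: le_trans (valP c) _; apply: ubm; exists c.
  by exists (exist _ m xm) => s Cs; apply: ubm; exists s.
exists t => // y ty; have xy := le_trans xt ty.
by have /(congr1 val) := maxt (exist _ y xy) ty.
Qed.

(* By the Lawson condition some Scott open [W] agrees with the complement of
   [z |-> y' <= z] on maximal elements; as every element lies below a maximal
   one, [W] consists of elements inconsistent with [y']. *)
Lemma strong_respect K : is_dcpo A -> is_basis K -> lawson_condition A ->
  strong_respect_for_totality (@Cset d A) (@Jset' d A).
Proof.
move=> dcpoA basisK lawson x totx; apply/seteqP; split=> // y _.
have [yx|nyx] := pselect (Cset x y); [by left | right].
(* Passing to some [y'] way below [y] reduces membership of [y] in the interior [Jset' x] to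
   membership of [y'] in [Jset x]. *)
have [y' ny'x y'y] := scott_open_way_below basisK (scott_open_Cset_compl x) nyx.
apply: (way_above_Jset' basisK) y'y.
have : relative_opens (@lawson_open d A) (total_set A)
    (~` [set z | (y' <= z)%O] `&` total_set A).
  by exists (~` [set z | (y' <= z)%O]) => //; apply: sub_gen_smallest; right; exists y'.
rewrite -lawson => -[W oW WE].
have : (W `&` total_set A) x.
  by rewrite WE; split=> //; exact: ny'x.
move=> [Wx _]; apply: (scott_interior_max oW) Wx => w Ww [z [y'z wz]].
have [t zt tott] := maximal_above z dcpoA.
have : (W `&` total_set A) t.
  by split=> //; apply: oW.1 (le_trans wz zt).
by rewrite WE => -[+ _]; apply; exact: le_trans zt.
Qed.

End ScottTopology.

Section RealSup.
Context {R : realType} {T : Type}.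
Implicit Types (B : set T) (f : T -> R).

Lemma sup_image_eq B f (c : R) : (forall x, B x -> f x <= c) ->
  (forall e, 0 < e -> exists2 x, B x & c < f x + e) -> c = sup (f @` B).
Proof.
(* The value [1] is arbitrary: it yields a point of [B], so that [sup] is a genuine least upper
   bound. *)
move=> ubc approx; have [x0 Bx0 _] := approx 1 ltr01.
have fB0 : f @` B !=set0 by exists (f x0), x0.
have ubB : ubound (f @` B) c by move=> _ [x Bx <-]; exact: ubc.
apply: le_anti; apply/andP; split; last exact: ge_sup.
apply/ler_addgt0Pr => e e0; have [x Bx cfx] := approx e e0.
apply: le_trans (ltW cfx) _; rewrite lerD2r.
by apply: ub_le_sup; [exists c | exists x].
Qed.

End RealSup.

(** * The extended measure and the axioms of the muInfo-structure *)

Section ValuationExtension.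
Context {R : realType} {d : Order.disp_t} {A : porderType d}.
Variables (mu nu : set A -> R) (K : set A).
Hypotheses (basisK : is_basis K) (hmu : cc_valuation mu).
Hypothesis (ext : ring_extension mu nu).
Implicit Types (x y z : A) (U V S B : set A) (e : R).

Local Notation M := (scott_ring A).

Lemma scott_ringP : setring M.
Proof. exact: smallest_setring. Qed.

Lemma scott_ring_open U : scott_open U -> M U.
Proof. exact: sub_setring. Qed.

Lemma scott_ringT : M setT.
Proof. exact: scott_ring_open scott_openT. Qed.

Lemma scott_ringI : setI_closed M.
Proof. exact: setring_setI scott_ringP. Qed.

Lemma scott_ringU : setU_closed M.
Proof. exact: setringU. Qed.

Lemma scott_ringD : setD_closed M.
Proof. exact: setringD. Qed.

Lemma scott_ring_Cset x : M (Cset x).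
Proof.
rewrite -[Cset x]setCK -setTD; apply: scott_ringD scott_ringT _.
by apply: scott_ring_open; exact: scott_open_Cset_compl.
Qed.

Lemma scott_ring_Jset' x : M (Jset' x).
Proof. by apply: scott_ring_open; exact: scott_interior_open. Qed.

Let fam : finitely_additive_measure M nu := ext.1.

Let nu_open U : scott_open U -> nu U = mu U := ext.2 U.

Let nu_mono : monotone_on M nu := measure_mono scott_ringP fam.

Let nu_split := measure_split scott_ringP fam.

Let nu_ge0 U : M U -> 0 <= nu U.
Proof. by case: fam => _ ge0 _; exact: ge0. Qed.

Let nu0 : nu set0 = 0.
Proof. by case: fam. Qed.

Let nuT : nu setT = 1.
Proof. by rewrite nu_open ?(cc_setT hmu)//; exact: scott_openT. Qed.

Lemma nu_disjointU U V : M U -> M V -> U `&` V = set0 ->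
  nu (U `|` V) = nu U + nu V.
Proof. by case: fam => _ _ add; exact: add. Qed.

Lemma nu_le1 U : M U -> nu U <= 1.
Proof. by move=> MU; rewrite -nuT nu_mono//; exact: scott_ringT. Qed.

Lemma nu_Cset_compl x : nu (~` Cset x) = 1 - nu (Cset x).
Proof.
rewrite -nuT (nu_split scott_ringT (scott_ring_Cset x)) setTI setTD.
by rewrite addrC addKr.
Qed.

(** The common property of [Cset] and [Jset'] behind axiom [mi_sup]: the measure at a directed
    supremum is approached inside the directed set. *)
Definition approximable (P : A -> set A) :=
  [/\ forall x, M (P x), forall x y, (x <= y)%O -> P x `<=` P y &
      forall B b e, directed B -> isLub B b -> 0 < e ->
        exists2 x, B x & nu (P b) < nu (P x) + e].

Lemma Cset_approximable : approximable Cset.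
Proof.
split=> [x|x y|B b e dirB lubB e0]; [exact: scott_ring_Cset | exact: CsetS |].
set F := [set ~` Cset x | x in B].
have openF : F `<=` @scott_open d A.
  by move=> _ [x _ <-]; exact: scott_open_Cset_compl.
have dirF : directed_by (fun U V => V `<=` U) F.
  split=> [|_ _ [x Bx <-] [y By <-]].
    by have [[x Bx] _] := dirB; exists (~` Cset x), x.
  have [z [Bz xz yz]] := dirB.2 x y Bx By.
  by exists (~` Cset z); split; [exists z | exact/subsetC/CsetS..].
have := cc_cocontinuous hmu openF dirF.
rewrite -(Cset_compl_sup dirB lubB) -nu_open; last exact: scott_open_Cset_compl.
move=> infE; have : inf (mu @` F) < nu (~` Cset b) + e by rewrite -infE ltrDl.
move=> /inf_lt[|_ [_ [x Bx <-] <-]].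
  by have [[U FU] _] := dirF; exists (mu U), U.
rewrite -nu_open; last exact: scott_open_Cset_compl.
by rewrite !nu_Cset_compl => lt; exists x => //; lra.
Qed.

Lemma Jset'_approximable : approximable Jset'.
Proof.
split=> [x|x y|B b e dirB lubB e0]; [exact: scott_ring_Jset' | exact: Jset'S |].
set F := [set Jset' x | x in B].
have openF : F `<=` @scott_open d A.
  by move=> _ [x _ <-]; exact: scott_interior_open.
have dirF : directed_by (fun U V => U `<=` V) F.
  split=> [|_ _ [x Bx <-] [y By <-]].
    by have [[x Bx] _] := dirB; exists (Jset' x), x.
  have [z [Bz xz yz]] := dirB.2 x y Bx By.
  by exists (Jset' z); split; [exists z | exact: Jset'S..].
have := cc_continuous hmu openF dirF.
rewrite -(Jset'_sup basisK dirB lubB) -nu_open; last exact: scott_interior_open.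
move=> supE; have : nu (Jset' b) - e < sup (mu @` F) by rewrite -supE gtrBl.
move=> /sup_gt[|_ [_ [x Bx <-] <-]].
  by have [[U FU] _] := dirF; exists (mu U), U.
rewrite -nu_open; last exact: scott_interior_open.
by move=> lt; exists x => //; lra.
Qed.

(** A point of the larger intersection lies in the smaller one or in one of the two differences, so
    the losses of the factors add up. *)
Lemma nu_setI_approx S S' V V' : M S -> M S' -> M V -> M V' ->
  S' `<=` S -> V' `<=` V ->
  nu (S `&` V) - nu (S' `&` V') <= (nu S - nu S') + (nu V - nu V').
Proof.
move=> MS MS' MV MV' SS VV.
rewrite (nu_split MS MS') (nu_split MV MV') (setIidr SS) (setIidr VV).
rewrite [nu S' + _]addrC [nu V' + _]addrC !addrK lerBlDr.
have MSS' : M (S `\` S') by exact: scott_ringD.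
have MVV' : M (V `\` V') by exact: scott_ringD.
have MSV' : M (S' `&` V') by exact: scott_ringI.
have le1 : nu (S `&` V) <= nu ((S `\` S') `|` (V `\` V') `|` (S' `&` V')).
  apply: nu_mono; first exact: scott_ringI.
    by do 2!apply: scott_ringU => //.
  move=> z [Sz Vz] /=; have [|] := pselect (S' z); have [|] := pselect (V' z); tauto.
have le2 U W : M U -> M W -> nu (U `|` W) <= nu U + nu W.
  move=> MU MW; rewrite (measure_modular scott_ringP fam MU MW) lerDr.
  by apply: nu_ge0; exact: scott_ringI.
apply: le_trans le1 _; apply: le_trans (le2 _ _ _ MSV') _; first exact: scott_ringU.
by rewrite lerD2r le2.
Qed.

Lemma directed_approx B b e : directed B -> isLub B b -> 0 < e ->
  exists2 x, B x & nu (Cset b) < nu (Cset x) + e /\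
                   nu (Jset' b) < nu (Jset' x) + e.
Proof.
move=> dirB lubB e0.
have [MC CS /(_ B b e dirB lubB e0)[x Bx ltx]] := Cset_approximable.
have [MJ JS /(_ B b e dirB lubB e0)[y By lty]] := Jset'_approximable.
have [z [Bz xz yz]] := dirB.2 x y Bx By.
have := nu_mono (MC x) (MC z) (CS _ _ xz).
have := nu_mono (MJ y) (MJ z) (JS _ _ yz).
by exists z => //; split; lra.
Qed.

Lemma nu_setI_sup P Q B b y : approximable P -> (forall x, M (Q x)) ->
  directed B -> isLub B b ->
  nu (P b `&` Q y) = sup [set nu (P x `&` Q y) | x in B].
Proof.
move=> [MP PS approx] MQ dirB lubB.
have MPQ x : M (P x `&` Q y) by exact: scott_ringI.
apply: sup_image_eq => [x Bx|e e0].
  by apply: nu_mono => //; apply: setSI; apply: PS; exact: lubB.1.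
have [x Bx lt] := approx B b e dirB lubB e0; exists x => //.
have Pxb : P x `<=` P b by apply: PS; exact: lubB.1.
have := nu_setI_approx (MP b) (MP x) (MQ y) (MQ y) Pxb (@subset_refl _ (Q y)).
by lra.
Qed.

(* No element outside [U] lies above an element of [U], so [Cset x `\` Cset y]
   contains [Cset x `&` U], whose measure is positive by strong
   non-degeneracy applied to [U `\` Cset x]. *)
Lemma Cset_separation U x : scott_open U -> U x ->
  exists2 e, 0 < e &
    forall y, nu (Cset x) - nu (Cset x `&` Cset y) < e -> U y.
Proof.
move=> oU Ux; exists (nu (U `&` Cset x)).
  have MU := scott_ring_open oU.
  have oUD : scott_open (U `\` Cset x).
    exact/scott_openI/scott_open_Cset_compl.
  rewrite -(ltrD2r (nu (U `\` Cset x))) -(nu_split MU (scott_ring_Cset x)) add0r.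
  rewrite !nu_open//; apply: (cc_nondegenerate hmu) => //; split.
    by move=> z [].
  by move=> /(_ x Ux)[_]; apply; exact: lexx.
move=> y; rewrite (nu_split (scott_ring_Cset x) (scott_ring_Cset y)) addrC addKr.
move=> lt; apply: contrapT => nUy; move: lt; apply/negP; rewrite -leNgt.
apply: nu_mono.
- exact: scott_ringI (scott_ring_open oU) (scott_ring_Cset x).
- exact: scott_ringD (scott_ring_Cset x) (scott_ring_Cset y).
by move=> z [Uz zx]; split=> // zy; apply: nUy; exact: oU.1 zy.
Qed.

Lemma scott_deficient_muInfo : deficient_muInfo M nu Cset Jset'.
Proof.
split.
- exact: setring0.
- exact: scott_ringT.
- exact: scott_ringI.
- exact: scott_ringU.
- exact: scott_ringD.
- by move=> U MU; rewrite nu_ge0//= nu_le1.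
- exact: scott_ring_Cset.
- exact: scott_ring_Jset'.
- exact: nuT.
- exact: nu0.
- exact: nu_mono.
- exact: (measure_modular scott_ringP fam).
- move=> x y; split=> [|/(_ x (lexx x))//]; exact: CsetS.
- move=> x y xy; split; first exact/CsetS/ltW.
  by move=> /(_ y (lexx y)) /(lt_le_trans xy); rewrite ltxx.
- exact: Cset_Jset'_disj.
- exact: Jset'S.
- move=> B b y P Q dirB lubB PE QE; apply: nu_setI_sup => //.
    by case: PE => ->; [exact: Cset_approximable | exact: Jset'_approximable].
  by case: QE => -> x; [exact: scott_ring_Cset | exact: scott_ring_Jset'].
- by move=> U x oU Ux; exact: Cset_separation.
Qed.

(** * The distances [u] and [l] *)

Local Notation u := (u_dist nu).
Local Notation l := (l_dist nu).

Let MC := scott_ring_Cset.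
Let MJ := scott_ring_Jset'.
Let MI := scott_ringI.

Lemma nu_setI_union V x : M V ->
  nu (V `&` (Cset x `|` Jset' x)) = nu (V `&` Cset x) + nu (V `&` Jset' x).
Proof.
move=> MV; rewrite setIUr nu_disjointU//; [exact: MI | exact: MI |].
by rewrite setIACA Cset_Jset'_disj setI0.
Qed.

(** Both unions are disjoint, so their intersection splits into four pieces: two are subtracted in
    [u], two are summed in [l]. The difference measures where [x] or [y] gives no information. *)
Lemma u_distBl_dist x y :
  u x y - l x y = 1 - nu ((Cset x `|` Jset' x) `&` (Cset y `|` Jset' y)).
Proof.
have MV : M (Cset x `|` Jset' x) by exact: scott_ringU.
rewrite nu_setI_union// [_ `&` Cset y]setIC [_ `&` Jset' y]setIC.
rewrite !nu_setI_union// /u_dist /l_dist.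
by rewrite [Jset' y `&` Cset x]setIC [Jset' y `&` Jset' x]setIC
  [Cset y `&` Cset x]setIC; ring.
Qed.

Lemma l_dist_ge0 x y : 0 <= l x y.
Proof. by rewrite addr_ge0// nu_ge0//; exact: MI. Qed.

Lemma l_dist_le_u_dist x y : l x y <= u x y.
Proof.
rewrite -subr_ge0 u_distBl_dist subr_ge0.
by apply: nu_le1; apply: MI; exact: scott_ringU.
Qed.

Lemma u_dist_sym x y : u x y = u y x.
Proof. by rewrite /u_dist setIC [Jset' x `&` _]setIC. Qed.

Lemma l_dist_sym x y : l x y = l y x.
Proof. by rewrite /l_dist addrC. Qed.

Lemma u_distS x x' y y' : (x <= x')%O -> (y <= y')%O -> u x' y' <= u x y.
Proof.
move=> xx yy; rewrite /u_dist.
have := nu_mono (MI (MC x) (MC y)) (MI (MC x') (MC y')) (setISS (CsetS xx) (CsetS yy)).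
have := nu_mono (MI (MJ x) (MJ y)) (MI (MJ x') (MJ y')) (setISS (Jset'S xx) (Jset'S yy)).
by lra.
Qed.

Lemma l_distS x x' y y' : (x <= x')%O -> (y <= y')%O -> l x y <= l x' y'.
Proof.
move=> xx yy; rewrite /l_dist.
have := nu_mono (MI (MC x) (MJ y)) (MI (MC x') (MJ y')) (setISS (CsetS xx) (Jset'S yy)).
have := nu_mono (MI (MC y) (MJ x)) (MI (MC y') (MJ x')) (setISS (CsetS yy) (Jset'S xx)).
by lra.
Qed.

Lemma u_dist_le x y : (x <= y)%O -> u x x = u x y.
Proof.
move=> xy; rewrite /u_dist !setIid (setIidl (CsetS xy)).
by rewrite (setIidl (Jset'S xy)).
Qed.

(** Modularity for the two left-hand intersections: their union lies in [V], their intersection in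
    that of [S] and [W]. *)
Lemma nu_setI_triangle S V W : M S -> M V -> M W ->
  nu (S `&` V) + nu (V `&` W) <= nu V + nu (S `&` W).
Proof.
move=> MS MV MW; have MSV := MI MS MV; have MVW := MI MV MW.
rewrite (measure_modular scott_ringP fam MSV MVW) addrC lerD//; apply: nu_mono => //.
- exact: scott_ringU.
- by move=> z [[]|[]].
- exact: MI.
- exact: MI.
- by move=> z [[? ?] [? ?]].
Qed.

Lemma u_dist_triangle x y z : u x z <= u x y + u y z - u y y.
Proof.
have := nu_setI_triangle (MC x) (MC y) (MC z).
have := nu_setI_triangle (MJ x) (MJ y) (MJ z).
by rewrite /u_dist !setIid; lra.
Qed.

(** The right-hand side also contains the analogous gap for [Jset'], which is nonnegative. *)
Lemma Cset_gap_le x y : nu (Cset x) - nu (Cset x `&` Cset y) <= u x y - u x x.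
Proof.
have := nu_mono (MI (MJ x) (MJ y)) (MJ x) (@subIsetl _ _ _).
by rewrite /u_dist !setIid; lra.
Qed.

Lemma u_dist_separation U x : scott_open U -> U x ->
  exists2 e, 0 < e & forall y, u x y < u x x + e -> U y.
Proof.
move=> oU Ux; have [e e0 sep] := Cset_separation oU Ux; exists e => // y lt.
by apply: sep; apply: le_lt_trans (Cset_gap_le x y) _; rewrite ltrBlDl.
Qed.

Lemma u_dist_small x y : u x x <= u x y.
Proof.
rewrite -subr_ge0; apply: le_trans (Cset_gap_le x y); rewrite subr_ge0.
by apply: nu_mono => //; exact: MI.
Qed.

Lemma u_dist_nle x y : ~ (x <= y)%O -> u x x < u x y.
Proof.
move=> nxy; rewrite ltNge; apply/negP => yx.
(* The complement of [Cset y] is an open set containing [x] but not [y]; the separation radius at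
   [x] would put [y] into it. *)
have [e e0 sep] := u_dist_separation (scott_open_Cset_compl y) nxy.
apply: (sep y); last exact: lexx.
by apply: le_lt_trans yx _; rewrite ltrDl.
Qed.

Lemma u_dist_partial_metric : partial_metric u.
Proof.
split.
- by move=> x y; apply: le_trans (l_dist_ge0 x y) (l_dist_le_u_dist x y).
- move=> x y; split=> [->//|[xx yy]]; apply: le_anti; apply/andP; split.
    by apply: contrapT => /u_dist_nle; rewrite xx ltxx.
  by apply: contrapT => /u_dist_nle; rewrite -yy u_dist_sym ltxx.
- exact: u_dist_small.
- exact: u_dist_sym.
- exact: u_dist_triangle.
- exact: u_dist_le.
- exact: u_dist_nle.
Qed.

Lemma l_dist_eq_u_dist x y :
  Cset x `|` Jset' x = setT -> Cset y `|` Jset' y = setT -> l x y = u x y.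
Proof.
move=> xT yT; apply/esym/eqP; rewrite -subr_eq0 u_distBl_dist xT yT setIT.
by rewrite nuT subrr.
Qed.

(** * The relaxed metric with values in intervals *)

Lemma dist_interval_subproof x y : (0 <= (l x y)%:E)%E && ((l x y)%:E <= (u x y)%:E)%E.
Proof. by rewrite !lee_fin l_dist_ge0 l_dist_le_u_dist. Qed.

Definition dist_interval (p : A *p A) : interval_dom R :=
  exist _ ((l p.1 p.2)%:E, (u p.1 p.2)%:E) (dist_interval_subproof p.1 p.2).

Lemma dist_interval_relaxed_metric : relaxed_metric dist_interval.
Proof.
split=> [x y|x y z].
  by apply: val_inj; rewrite /= l_dist_sym u_dist_sym.
rewrite /upper /= -EFinD lee_fin; apply: le_trans (u_dist_triangle x y z) _.
by rewrite gerBl; exact: le_trans (l_dist_ge0 y y) (l_dist_le_u_dist y y).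
Qed.

(** Each distance involves two intersections of two sets, and each of these four factors loses less
    than [e]. *)
Lemma dist_approx x x' y y' e : (x <= x')%O -> (y <= y')%O ->
  nu (Cset x') < nu (Cset x) + e /\ nu (Jset' x') < nu (Jset' x) + e ->
  nu (Cset y') < nu (Cset y) + e /\ nu (Jset' y') < nu (Jset' y) + e ->
  l x' y' <= l x y + e *+ 4 /\ u x y <= u x' y' + e *+ 4.
Proof.
move=> xx yy [Cx Jx] [Cy Jy].
have Cxx := CsetS xx; have Jxx := Jset'S xx.
have Cyy := CsetS yy; have Jyy := Jset'S yy.
have := nu_setI_approx (MC x') (MC x) (MC y') (MC y) Cxx Cyy.
have := nu_setI_approx (MC x') (MC x) (MJ y') (MJ y) Cxx Jyy.
have := nu_setI_approx (MC y') (MC y) (MJ x') (MJ x) Cyy Jxx.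
have := nu_setI_approx (MJ x') (MJ x) (MJ y') (MJ y) Jxx Jyy.
by rewrite /l_dist /u_dist; split; lra.
Qed.

Lemma dist_interval_scott_continuous : scott_continuous dist_interval.
Proof.
have mono : {homo dist_interval : p q / (p <= q)%O}.
  move=> p q; rewrite leEprod => /andP[le1 le2].
  by apply/andP; split; rewrite lee_fin; [exact: l_distS | exact: u_distS].
split=> // S s dirS lubS.
have S_le p : S p -> (p.1 <= s.1)%O /\ (p.2 <= s.2)%O.
  by move=> /lubS.1; rewrite leEprod => /andP.
have dir1 : directed [set p.1 | p in S].
  split=> [|_ _ [p Sp <-] [q Sq <-]]; first by have [[p Sp] _] := dirS; exists p.1, p.
  have [r [Sr]] := dirS.2 p q Sp Sq; rewrite !leEprod => /andP[pr _] /andP[qr _].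
  by exists r.1; split=> //; exists r.
have dir2 : directed [set p.2 | p in S].
  split=> [|_ _ [p Sp <-] [q Sq <-]]; first by have [[p Sp] _] := dirS; exists p.2, p.
  have [r [Sr]] := dirS.2 p q Sp Sq; rewrite !leEprod => /andP[_ pr] /andP[_ qr].
  by exists r.2; split=> //; exists r.
have lub1 : isLub [set p.1 | p in S] s.1.
  split=> [_ [p Sp <-]|b ubb]; first exact: (S_le p Sp).1.
  suff : (s <= ((b, s.2) : A *p A))%O by rewrite leEprod => /andP[].
  by apply: lubS.2 => p Sp; rewrite leEprod /= (S_le p Sp).2 ubb//; exists p.
have lub2 : isLub [set p.2 | p in S] s.2.
  split=> [_ [p Sp <-]|b ubb]; first exact: (S_le p Sp).2.
  suff : (s <= ((s.1, b) : A *p A))%O by rewrite leEprod => /andP[].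
  by apply: lubS.2 => p Sp; rewrite leEprod /= (S_le p Sp).1 ubb//; exists p.
(* [dist_approx] costs four errors, hence [e / 4]; an element [r] of [S] above both witnesses, each
   in its own coordinate, serves for the pair. *)
have approx e : 0 < e -> exists2 p, S p &
    l s.1 s.2 <= l p.1 p.2 + e /\ u p.1 p.2 <= u s.1 s.2 + e.
  move=> e0; have e40 : 0 < e / 4%:R by rewrite divr_gt0.
  have [_ [p Sp <-] [Cp Jp]] := directed_approx dir1 lub1 e40.
  have [_ [q Sq <-] [Cq Jq]] := directed_approx dir2 lub2 e40.
  have [r [Sr]] := dirS.2 p q Sp Sq; rewrite !leEprod => /andP[pr _] /andP[_ qr].
  exists r => //; have [r1 r2] := S_le r Sr.
  have -> : e = (e / 4%:R) *+ 4 by rewrite -mulr_natr divfK.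
  have := nu_mono (MC _) (MC _) (CsetS pr); have := nu_mono (MC _) (MC _) (CsetS qr).
  have := nu_mono (MJ _) (MJ _) (Jset'S pr); have := nu_mono (MJ _) (MJ _) (Jset'S qr).
  by move=> ? ? ? ?; apply: dist_approx => //; split; lra.
split=> [_ [p Sp <-]|i ubi]; first exact/mono/lubS.1.
apply/andP; split; apply/lee_addgt0Pr => e e0; have [p Sp [lp up]] := approx e e0.
- apply: (@le_trans _ _ ((l p.1 p.2)%:E + e%:E)%E); first by rewrite -EFinD lee_fin.
  rewrite leeD2r//; have : (dist_interval p <= i)%O by apply: ubi; exists p.
  by move=> /andP[].
- apply: (@le_trans _ _ (u p.1 p.2)%:E); last by rewrite -EFinD lee_fin.
  have : (dist_interval p <= i)%O by apply: ubi; exists p.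
  by move=> /andP[].
Qed.

Lemma u_dist_ball_open x e : scott_open [set y | u x y < e].
Proof.
split=> [y z xy yz|S s dirS lubS /= xs].
  by apply: le_lt_trans xy; exact: u_distS.
(* Moving from [s] to [y] costs one error for [Cset] and one for [Jset'], so a quarter of the
   remaining margin more than suffices. *)
have e0 : 0 < (e - u x s) / 4%:R by rewrite divr_gt0// subr_gt0.
have [y Sy approx] := directed_approx dirS lubS e0.
exists y; split=> //=; set r := _ / _ in e0 approx.
have rE : r *+ 4 = e - u x s by rewrite -mulr_natr divfK.
have ys : (y <= s)%O by exact: lubS.1.
have [approxC approxJ] := approx; have := Cset_approximable.
have : u x y <= u x s + (nu (Cset s) - nu (Cset y)) + (nu (Jset' s) - nu (Jset' y)).
  have := nu_setI_approx (MC x) (MC x) (MC s) (MC y) (@subset_refl _ _) (CsetS ys).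
  have := nu_setI_approx (MJ x) (MJ x) (MJ s) (MJ y) (@subset_refl _ _) (Jset'S ys).
  by rewrite /u_dist; lra.
by move: rE; lra.
Qed.

(** Scott open sets contain balls by separation. Conversely, [u x x = u x y] for [y] above [x], so
    [y] lies in every admissible ball around [x]; and the ball around a directed supremum is Scott
    open, so it meets the directed set. *)
Lemma dist_interval_open : relaxed_metric_open dist_interval = @scott_open d A.
Proof.
apply/seteqP; split=> U; last first.
  move=> oU x Ux; have [e e0 sep] := u_dist_separation oU Ux.
  exists (u x x + e); first by rewrite lte_fin ltrDl.
  by move=> y /=; rewrite lte_fin; exact: sep.
move=> openU; split=> [x y Ux xy|S s dirS lubS Us].
  have [e xe ball] := openU x Ux; apply: ball.
  by move: xe; rewrite /= /upper /= (u_dist_le xy).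
have [e se ball] := openU s Us.
have [y [Sy sy]] := (u_dist_ball_open s e).2 S s dirS lubS se.
by exists y; split=> //; apply: ball.
Qed.

(** * Maximal elements under strong respect for totality *)

Section Total.
Hypothesis total_respect : strong_respect_for_totality (@Cset d A) (@Jset' d A).

Lemma l_dist_total x y : total_set A x -> total_set A y -> l x y = u x y.
Proof. by move=> tx ty; apply: l_dist_eq_u_dist; exact: total_respect. Qed.

(** Here [u x x] equals [l x x], twice the measure of the empty intersection of [Cset x] and
    [Jset' x]. *)
Lemma u_dist_total x : total_set A x -> u x x = 0.
Proof.
move=> tx; rewrite -l_dist_total// /l_dist.
by rewrite Cset_Jset'_disj nu0 addr0.
Qed.

Lemma l_dist_metric : metric_on (total_set A) l.
Proof.
split=> [x y _ _|x y tx ty|x y _ _|x y z tx ty tz].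
- exact: l_dist_ge0.
- rewrite l_dist_total//; split=> [xy|<-]; last exact: u_dist_total.
  by apply/(pm_eq u_dist_partial_metric); rewrite xy !u_dist_total.
- exact: l_dist_sym.
- rewrite !l_dist_total//; apply: le_trans (u_dist_triangle x y z) _.
  by rewrite u_dist_total// subr0.
Qed.

Lemma l_dist_opens : metric_opens_on (total_set A) l =
  relative_opens (@scott_open d A) (total_set A).
Proof.
apply/seteqP; split=> V; last first.
  move=> [U oU <-]; split=> [x []//|x [Ux tx]].
  have [e e0 sep] := u_dist_separation oU Ux; exists e => // y [ty xy].
  by split=> //; apply: sep; rewrite u_dist_total// add0r -l_dist_total.
(* The Scott open witness is the union of all open sets whose trace lies in [V]; small [u]-balls
   around points of [V] are among them, and vanishing self-distance puts each centre in its ball. *)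
move=> [VT openV]; pose F := [set W | scott_open W /\ W `&` total_set A `<=` V].
exists (\bigcup_(W in F) W); first by apply: scott_open_bigcup => W [].
apply/seteqP; split=> [x [[W [_ WV] Wx] tx]|x Vx]; first exact: WV.
have tx := VT x Vx; split=> //; have [e e0 ball] := openV x Vx.
exists [set y | u x y < e]; last by rewrite /= u_dist_total.
split; first exact: u_dist_ball_open.
by move=> y [/= xy ty]; apply: ball; split=> //; rewrite l_dist_total.
Qed.

End Total.

End ValuationExtension.

Theorem mainTheorem10 (R : realType) (d : Order.disp_t) (A : porderType d)
    (mu : set A -> R) (hA : continuous_dcpo A) (hmu : cc_valuation mu) :
  (exists nu, ring_extension mu nu) /\
  (forall nu nu', ring_extension mu nu -> ring_extension mu nu' ->
     forall S, scott_ring A S -> nu S = nu' S) /\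
  (forall nu, ring_extension mu nu ->
     [/\ deficient_muInfo (scott_ring A) nu Cset Jset',
         partial_metric (u_dist nu),
         (exists rho : A *p A -> interval_dom R,
            [/\ (forall x y, lower (rho (x, y)) = (l_dist nu x y)%:E /\
                             upper (rho (x, y)) = (u_dist nu x y)%:E),
                relaxed_metric rho,
                scott_continuous rho &
                relaxed_metric_open rho = @scott_open d A]) &
         lawson_condition A ->
         [/\ muInfo_structure (scott_ring A) nu Cset Jset',
             (forall x y, total_set A x -> total_set A y -> l_dist nu x y = u_dist nu x y),
             metric_on (total_set A) (l_dist nu) &
             metric_opens_on (total_set A) (l_dist nu) =
             relative_opens (@scott_open d A) (total_set A)]]).
Proof.
have [dcpoA [K basisK]] := hA.
split; [|split].
- have [nu fam num] := extension_exists scott_open0 scott_openT (@scott_openI d A)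
    (@scott_openU d A) (cc_set0 hmu) (cc_mono hmu) (cc_modular hmu).
  by exists nu; split.
- move=> nu nu' [fam num] [fam' nu'm].
  exact: (extension_unique scott_open0 scott_openT (@scott_openI d A)) nu'm.
move=> nu ext; have deficient := scott_deficient_muInfo basisK hmu ext.
split=> //; first exact: u_dist_partial_metric hmu ext.
- exists (dist_interval hmu ext); split=> //.
  + exact: dist_interval_relaxed_metric.
  + exact: dist_interval_scott_continuous basisK _ _.
  + exact: dist_interval_open basisK _ _.
- move=> /(strong_respect dcpoA basisK) respect; split.
  + by split.
  + exact: l_dist_total hmu ext respect.
  + exact: l_dist_metric hmu ext respect.
  + exact: l_dist_opens basisK hmu ext respect.
Qed.
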